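(* Let $U_*=\begin{pmatrix}1&0&0\\0&0&0\\0&0&0\end{pmatrix}$. An affine subspace $E\subset\mathbb{S}^3$ satisfies $\mathbb{S}^3_+\cap E=\{U_*\}$ and $\dim E=3$ if and only if there exist $c_1,\ldots,c_8\in\mathbb{R}$ and an orthogonal matrix $\tilde P\in\mathbb{R}^{2\times2}$ such that $$E=\{X\in\mathbb{S}^3:\langle A_1,X\rangle=1,\ \langle A_2,X\rangle=0,\ \langle A_3,X\rangle=0\},$$ where, with $P=\begin{pmatrix}1&0\\0&\tilde P\end{pmatrix}\in\mathbb{R}^{3\times3}$ (block diagonal), the matrices $A_1,A_2,A_3$ are of one of the following two types. Type 1: $$A_1=P\begin{pmatrix}1&c_1&c_2\\c_1&c_3&c_4\\c_2&c_4&0\end{pmatrix}P^T,\quad A_2=P\begin{pmatrix}0&c_5&c_6\\c_5&c_7&c_8\\c_6&c_8&0\end{pmatrix}P^T,\quad A_3=P\begin{pmatrix}0&0&0\\0&\mu&0\\0&0&1\end{pmatrix}P^T$$ for some $\mu>0$, with $A_2\neq O$; or Type 2: $$A_1=P\begin{pmatrix}1&c_1&c_2\\c_1&0&c_3\\c_2&c_3&0\end{pmatrix}P^T,\quad A_2=P\begin{pmatrix}0&0&c_4\\0&1&c_5\\c_4&c_5&0\end{pmatrix}P^T,\quad A_3=P\begin{pmatrix}0&0&0\\0&0&0\\0&0&1\end{pmatrix}P^T.$$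
   Context: $\mathbb{S}^3$ is the space of real symmetric $3\times3$ matrices with inner product $\langle A,B\rangle=\operatorname{tr}(A^TB)$; $\mathbb{S}^3_+$ is the cone of positive semidefinite matrices; $O$ is the zero matrix. *)

(* Defs.v *)
From HB Require Import structures.
From mathcomp Require Import all_boot all_order all_algebra.
From mathcomp Require Import boolp classical_sets reals.
Set Implicit Arguments.
Unset Strict Implicit.
Unset Printing Implicit Defensive.
Import Order.TTheory GRing.Theory Num.Theory.
Local Open Scope classical_set_scope.
Local Open Scope ring_scope.

Definition sym_space (R : realType) (n : nat) : set 'M[R]_n :=
  [set X | X \is symmetricmx].

Definition psd_cone (R : realType) (n : nat) : set 'M[R]_n :=
  [set X | sym_space X /\ forall x : 'cV[R]_n, 0 <= (x^T *m X *m x) 0 0].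

Definition mx_inner (R : realType) (n : nat) (A B : 'M[R]_n) : R :=
  \tr (A^T *m B).

(* The direction [V] is determined by [E], so [d] is the dimension of [E]. *)
Definition affine_subspace_dim (R : realType) (n d : nat) (E : set 'M[R]_n)
    : Prop :=
  exists (X0 : 'M[R]_n) (V : {vspace 'M[R]_n}),
    [/\ sym_space X0,
        [set` V] `<=` @sym_space R n,
        E = [set X0 + v | v in [set` V]]
      & \dim V = d].

Definition affine_subspace (R : realType) (n : nat) (E : set 'M[R]_n) : Prop :=
  exists d : nat, affine_subspace_dim d E.

Definition orthogonal_mx (R : realType) (n : nat) (P : 'M[R]_n) : Prop :=
  P^T *m P = 1%:M.

Definition mx3 (R : realType)
    (a00 a01 a02 a10 a11 a12 a20 a21 a22 : R) : 'M[R]_3 :=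
  \matrix_(i < 3, j < 3)
    nth 0 (nth [::] [:: [:: a00; a01; a02];
                        [:: a10; a11; a12];
                        [:: a20; a21; a22]] i) j.

(* The block size 1 + 2 is convertible to 3. *)
Definition diag_block1 (R : realType) (Pt : 'M[R]_2) : 'M[R]_3 :=
  block_mx (1%:M : 'M[R]_1) 0 0 Pt.

Definition Ustar (R : realType) : 'M[R]_3 :=
  mx3 1 0 0
      0 0 0
      0 0 0.

Definition type1 (R : realType) (c1 c2 c3 c4 c5 c6 c7 c8 : R) (P : 'M[R]_3)
    (A1 A2 A3 : 'M[R]_3) : Prop :=
  [/\ A1 = P *m mx3 1  c1 c2
                    c1 c3 c4
                    c2 c4 0 *m P^T,
      A2 = P *m mx3 0  c5 c6
                    c5 c7 c8
                    c6 c8 0 *m P^T,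
      exists2 mu : R, 0 < mu &
        A3 = P *m mx3 0 0  0
                      0 mu 0
                      0 0  1 *m P^T
    & A2 <> 0].

Definition type2 (R : realType) (c1 c2 c3 c4 c5 : R) (P : 'M[R]_3)
    (A1 A2 A3 : 'M[R]_3) : Prop :=
  [/\ A1 = P *m mx3 1  c1 c2
                    c1 0  c3
                    c2 c3 0 *m P^T,
      A2 = P *m mx3 0  0  c4
                    0  1  c5
                    c4 c5 0 *m P^T
    & A3 = P *m mx3 0 0 0
                    0 0 0
                    0 0 1 *m P^T].

(* Main.v *)
(* Write E = U_* + V. A matrix v in V whose quadratic form is bounded below by a
   multiple of - x_0^2 is a feasible direction of the cone at U_*, hence is 0.
   Project diag(0, I_2) orthogonally onto V + {matrices supported on row and
   column 0}: the residual is 0 (+) B with B orthogonal to the lower blocks of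
   V, and the lower block C of the projection satisfies B + C = I_2,
   |B|^2 = tr B and |C|^2 = tr C. If tr B < 1, then det C > 0 and C would give a
   feasible direction; so tr B >= 1, which forces B to be positive semidefinite.
   Rotating B to a multiple of diag(mu, 1) gives A_3. The matrices A_1 and A_2
   are then obtained by separating a suitable symmetric matrix from V enlarged
   by the entries in which A_1 or A_2 has to vanish. *)
From HB Require Import structures.
Require Import Defs.
From mathcomp Require Import all_boot all_order all_algebra.
From mathcomp Require Import boolp classical_sets reals.
From mathcomp Require Import ring lra.
Import Order.TTheory GRing.Theory Num.Theory.
Local Open Scope classical_set_scope.
Local Open Scope ring_scope.

Lemma sym_spaceP (R : realType) (n : nat) (X : 'M[R]_n) :
  sym_space X <-> X^T = X.
Proof.
rewrite /sym_space /= is_hermitianmxE expr0 scale1r map_mx_id //.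
by split=> [/eqP|->].
Qed.

(** * The trace inner product: orthogonal projection and separation *)

Section Inner.
Context {R : realType} {n : nat}.
Implicit Types A B X Y : 'M[R]_n.

Fact mx_inner_is_scalar A : scalar (@mx_inner R n A).
Proof. by move=> a X Y; rewrite /mx_inner mulmxDr -scalemxAr linearP. Qed.

HB.instance Definition _ A :=
  GRing.isLinear.Build R 'M[R]_n R _ (@mx_inner R n A) (mx_inner_is_scalar A).

Lemma mx_innerC A B : mx_inner A B = mx_inner B A.
Proof. by rewrite /mx_inner -mxtrace_tr trmx_mul trmxK. Qed.

Lemma mx_innerE A B : mx_inner A B = \sum_i \sum_j A j i * B j i.
Proof.
by rewrite /mx_inner; apply: eq_bigr => i _; rewrite mxE;
  apply: eq_bigr => j _; rewrite mxE.
Qed.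

Lemma mx_inner_eq0 A : mx_inner A A = 0 -> A = 0.
Proof.
rewrite mx_innerE => /eqP.
rewrite psumr_eq0 => [/allP h|i _]; last by apply: sumr_ge0 => j _; exact: sqr_ge0.
apply/matrixP => i j; rewrite mxE; have := h j (mem_index_enum _).
rewrite psumr_eq0 => [/allP /(_ i (mem_index_enum _))|k _]; last exact: sqr_ge0.
by rewrite /= mulf_eq0 orbb => /eqP.
Qed.

Lemma mx_inner_conj (P : 'M[R]_n) A Y :
  mx_inner A (P *m Y *m P^T) = mx_inner (P^T *m A *m P) Y.
Proof. by rewrite /mx_inner !mulmxA mxtrace_mulC !trmx_mul trmxK !mulmxA. Qed.

(** Gram-Schmidt by induction on [s]: [u'] is the part of [u] orthogonal to the span of [s], so
    correcting [C] along [u'] keeps the residual orthogonal to [s]. *)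
Lemma span_projection (s : seq 'M[R]_n) X :
  exists2 C, C \in <<s>>%VS &
    forall D, D \in <<s>>%VS -> mx_inner D (X - C) = 0.
Proof.
elim: s X => [|u s IHs] X.
  exists 0 => [|D]; first exact: mem0v.
  by rewrite span_nil memv0 => /eqP ->; rewrite mx_innerC linear0.
have [c cs hc] := IHs u; have [C Cs hC] := IHs X.
set u' := u - c in hc.
pose k := mx_inner u' (X - C) / mx_inner u' u'.
have u's : u' \in <<u :: s>>%VS.
  by rewrite span_cons memv_add ?memv_line ?rpredN.
exists (C + k *: u').
  rewrite rpredD ?rpredZ //.
  by rewrite span_cons -[C]add0r memv_add ?mem0v.
move=> D; rewrite span_cons => /memv_addP [_ /vlineP [a ->]] [d ds ->].
have -> : a *: u + d = a *: u' + (a *: c + d).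
  by rewrite addrA -scalerDr subrK.
have ds' : a *: c + d \in <<s>>%VS by rewrite rpredD ?rpredZ.
have innerE B : mx_inner B (X - (C + k *: u')) = mx_inner B (X - C) - k * mx_inner B u'.
  by rewrite opprD addrA linearB linearZ.
rewrite mx_innerC linearP /= ![mx_inner (X - _) _]mx_innerC !innerE.
rewrite (hC _ ds') (hc _ ds') mulr0 subr0 addr0.
have [u'0|u'0] := eqVneq (mx_inner u' u') 0.
  by rewrite (mx_inner_eq0 _ u'0) [mx_inner 0 _]mx_innerC !linear0 !mulr0 subr0 mulr0.
by rewrite /k divfK // subrr mulr0.
Qed.

Lemma vspace_projection (W : {vspace 'M[R]_n}) X :
  exists2 C, C \in W & forall D, D \in W -> mx_inner D (X - C) = 0.
Proof. by rewrite -(span_basis (vbasisP W)); exact: span_projection. Qed.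

(** The normalized residual of the projection of [X] onto [W] works: it is orthogonal to [W], and
    before normalization its pairing with [X] is its squared norm, nonzero since [X] lies outside
    [W]. *)
Lemma vspace_separation (W : {vspace 'M[R]_n}) X :
    (forall D, D \in W -> D^T = D) -> X^T = X -> X \notin W ->
  exists A, [/\ A^T = A, forall D, D \in W -> mx_inner A D = 0
              & mx_inner A X = 1].
Proof.
move=> symW symX XW; have [C CW hC] := vspace_projection W X.
have AA : mx_inner (X - C) X = mx_inner (X - C) (X - C).
  by rewrite [RHS]linearB /= [mx_inner _ C]mx_innerC hC // subr0.
have A0 : mx_inner (X - C) (X - C) != 0.
  by apply: contra XW => /eqP /mx_inner_eq0 /eqP; rewrite subr_eq0 => /eqP ->.
exists ((mx_inner (X - C) (X - C))^-1 *: (X - C)); split.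
- by apply/matrixP => i j; have /matrixP/(_ i j) := symX;
    have /matrixP/(_ i j) := symW _ CW; rewrite !mxE => -> ->.
- by move=> D DW; rewrite mx_innerC linearZ /= (hC _ DW) mulr0.
- by rewrite [LHS]mx_innerC linearZ /= [mx_inner X _]mx_innerC AA mulVf.
Qed.

End Inner.

(** * Coordinates and dimension count for symmetric matrices of order 3 *)

Section Dim3.
Context {R : realType}.
Implicit Types A X Y : 'M[R]_3.

Lemma big_ord3 (F : 'I_3 -> R) : \sum_i F i = F 0 + F 1 + F 2.
Proof.
rewrite !big_ord_recl big_ord0 addr0 addrA.
by congr (_ + F _ + F _); apply/val_inj.
Qed.

Lemma eq_mx3 X Y :
  [/\ X 0 0 = Y 0 0, X 0 1 = Y 0 1 & X 0 2 = Y 0 2] ->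
  [/\ X 1 0 = Y 1 0, X 1 1 = Y 1 1 & X 1 2 = Y 1 2] ->
  [/\ X 2 0 = Y 2 0, X 2 1 = Y 2 1 & X 2 2 = Y 2 2] -> X = Y.
Proof.
move=> [h1 h2 h3] [h4 h5 h6] [h7 h8 h9]; apply/matrixP.
have I3 (i : 'I_3) : [\/ i = 0, i = 1 | i = 2].
  by case: i => [[|[|[|//]]] hi]; [apply: Or31|apply: Or32|apply: Or33];
    apply/val_inj.
by move=> i j; case: (I3 i) => ->; case: (I3 j) => ->.
Qed.

Definition sym3 (a b c d e f : R) : 'M[R]_3 := mx3 a b c b d e c e f.

Lemma sym3_tr a b c d e f : (sym3 a b c d e f)^T = sym3 a b c d e f.
Proof. by apply: eq_mx3; rewrite !mxE. Qed.

Lemma sym3E X : X^T = X ->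
  X = sym3 (X 0 0) (X 0 1) (X 0 2) (X 1 1) (X 1 2) (X 2 2).
Proof.
move=> /matrixP symX.
have [h1 h2 h3] : [/\ X 1 0 = X 0 1, X 2 0 = X 0 2 & X 2 1 = X 1 2].
  by split; rewrite -[LHS]symX mxE.
by apply: eq_mx3; rewrite !mxE.
Qed.

Lemma mx_inner_sym3 a b c d e f a' b' c' d' e' f' :
  mx_inner (sym3 a b c d e f) (sym3 a' b' c' d' e' f') =
  a * a' + d * d' + f * f' + 2 * (b * b' + c * c' + e * e').
Proof. by rewrite mx_innerE !big_ord3 !mxE /=; ring. Qed.

Lemma quad_sym3 a b c d e f (x : 'cV[R]_3) :
  (x^T *m sym3 a b c d e f *m x) 0 0 =
  a * x 0 0 ^+ 2 + d * x 1 0 ^+ 2 + f * x 2 0 ^+ 2 +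
  2 * (b * x 0 0 * x 1 0 + c * x 0 0 * x 2 0 + e * x 1 0 * x 2 0).
Proof. by rewrite !(mxE, big_ord3) /=; ring. Qed.

Definition sym3_row (r : 'rV[R]_6) : 'M[R]_3 :=
  sym3 (r 0 0) (r 0 1) (r 0 2) (r 0 3) (r 0 4) (r 0 5).

Fact sym3_row_is_linear : linear sym3_row.
Proof. by move=> a r s; apply: eq_mx3; rewrite !mxE. Qed.

HB.instance Definition _ :=
  GRing.isLinear.Build R 'rV[R]_6 'M[R]_3 _ sym3_row sym3_row_is_linear.

(** Encoded as an image so that injectivity of [sym3_row] yields dimension 6. *)
Definition symv : {vspace 'M[R]_3} := limg (linfun sym3_row).

Lemma symvP X : reflect (X^T = X) (X \in symv).
Proof.
apply: (iffP memv_imgP) => [[r _ ->]|/sym3E ->].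
  by rewrite lfunE /= sym3_tr.
exists (\row_i nth 0 [:: X 0 0; X 0 1; X 0 2; X 1 1; X 1 2; X 2 2] i).
  exact: memvf.
by rewrite lfunE /= /sym3_row !mxE.
Qed.

Lemma dim_symv : \dim symv = 6.
Proof.
rewrite limg_dim_eq ?dimvf ?dim_matrix //.
apply/eqP; rewrite -subv0; apply/subvP => r.
rewrite memv_cap memvf memv_ker lfunE memv0 /= => /eqP /matrixP h.
apply/eqP/rowP => i; rewrite [RHS]mxE.
rewrite /sym3_row in h.
have [h0 h1 h2] := And3 (h 0 0) (h 0 1) (h 0 2).
have [h3 h4 h5] := And3 (h 1 1) (h 1 2) (h 2 2).
rewrite !mxE /= in h0 h1 h2 h3 h4 h5.
by case: i => [[|[|[|[|[|[|//]]]]]] hi];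
  [rewrite -[RHS]h0|rewrite -[RHS]h1|rewrite -[RHS]h2
  |rewrite -[RHS]h3|rewrite -[RHS]h4|rewrite -[RHS]h5];
  congr (r _ _); apply/val_inj.
Qed.

(* The point [J] and the triangular shape of the pairings replace linear
   independence of the [A_i]. *)
Lemma dim_orthogonal3 A1 A2 A3 U J :
    A2^T = A2 -> U^T = U -> J^T = J -> A2 <> 0 ->
    [/\ mx_inner A1 U = 1, mx_inner A2 U = 0 & mx_inner A3 U = 0] ->
    [/\ mx_inner A1 J = 0, mx_inner A2 J = 0 & mx_inner A3 J = 1] ->
  exists2 K : {vspace 'M[R]_3}, \dim K = 3 &
    forall X, X \in K <-> [/\ X^T = X, mx_inner A1 X = 0, mx_inner A2 X = 0
                           & mx_inner A3 X = 0].
Proof.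
move=> symA2 symU symJ A20 [u1 u2 u3] [j1 j2 j3].
pose f X : 'rV[R]_3 := \row_i mx_inner (nth 0 [:: A1; A2; A3] i) X.
have flin : linear f by move=> a X Y; apply/rowP => i; rewrite !mxE linearP.
pose fL := GRing.isLinear.Build R 'M[R]_3 'rV[R]_3 _ f flin.
pose g : {linear 'M[R]_3 -> 'rV[R]_3} := HB.pack f fL.
pose h := linfun g.
exists (symv :&: lker h)%VS.
  have := limg_ker_dim h symv; rewrite dim_symv.
  suff -> : (h @: symv = fullv)%VS.
    by rewrite dimvf dim_matrix => /(@addIn 3 _ 3).
  apply/eqP; rewrite eqEsubv subvf /=; apply/subvP => y _.
  have a20 : mx_inner A2 A2 != 0 by apply/eqP => /mx_inner_eq0.
  (* [k] fixes the second coordinate, to which [U] and [J] contribute nothing; these then adjust the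
     first and the third separately. *)
  pose k := y 0 1 / mx_inner A2 A2.
  apply/memv_imgP; exists (k *: A2 + (y 0 0 - k * mx_inner A1 A2) *: U
                           + (y 0 2 - k * mx_inner A3 A2) *: J).
    by apply/symvP; rewrite !linearD !linearZ /= symA2 symU symJ.
  rewrite lfunE /=; apply/rowP => i; rewrite mxE !linearD !linearZ /=.
  case: i => [[|[|[|//]]] hi] /=.
  - rewrite u1 j1; rewrite (_ : Ordinal hi = 0); [ring|exact/val_inj].
  - rewrite u2 j2 !mulr0 !addr0 divfK //; congr (y _ _); exact/val_inj.
  - rewrite u3 j3; rewrite (_ : Ordinal hi = 2); [ring|exact/val_inj].
move=> X; rewrite memv_cap memv_ker lfunE /=; split.
  move=> /andP [/symvP symX /eqP /rowP hX]; split => //.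
  - by have := hX 0; rewrite !mxE.
  - by have := hX 1; rewrite !mxE.
  - by have := hX 2; rewrite !mxE.
move=> [/symvP -> x1 x2 x3] /=; apply/eqP/rowP => i; rewrite !mxE.
by case: i => [[|[|[|//]]] hi].
Qed.

End Dim3.

(** * Conjugation by orthogonal matrices and tests for semidefiniteness *)

Section Conjugation.
Context {R : realType}.
Implicit Types (P X Y : 'M[R]_3) (Pt : 'M[R]_2).

Lemma diag_block1E Pt :
  diag_block1 Pt = mx3 1 0 0 0 (Pt 0 0) (Pt 0 1) 0 (Pt 1 0) (Pt 1 1).
Proof.
rewrite /diag_block1.
have e0 : (0 : 'I_3) = lshift 2 (0 : 'I_1) by exact/val_inj.
have e1 : (1 : 'I_3) = rshift 1 (0 : 'I_2) by exact/val_inj.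
have e2 : (2 : 'I_3) = rshift 1 (1 : 'I_2) by exact/val_inj.
apply: eq_mx3; split; rewrite [RHS]mxE /= ?e2 ?e0 ?e1;
  by rewrite ?(@block_mxEul _ 1 2 1 2) ?(@block_mxEur _ 1 2 1 2)
    ?(@block_mxEdl _ 1 2 1 2) ?(@block_mxEdr _ 1 2 1 2) ?mxE.
Qed.

Lemma orthogonal_mxV n (P : 'M[R]_n) : orthogonal_mx P -> P *m P^T = 1%:M.
Proof. exact: mulmx1C. Qed.

Lemma orthogonal_diag_block1 Pt :
  orthogonal_mx Pt -> orthogonal_mx (diag_block1 Pt).
Proof.
move=> h; rewrite /orthogonal_mx /diag_block1.
rewrite (@tr_block_mx _ 1 2 1 2) (@mulmx_block _ 1 2 1 2 1 2).
rewrite !trmx0 trmx1 !(mulmx0, mul0mx, mulmx1, addr0, add0r) h.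
exact: esym (@scalar_mx_block _ 1 2 1).
Qed.

Lemma Ustar_sym3 : Ustar R = sym3 1 0 0 0 0 0.
Proof. by []. Qed.

Lemma diag_block1_Ustar Pt :
  diag_block1 Pt *m Ustar R *m (diag_block1 Pt)^T = Ustar R.
Proof.
by rewrite diag_block1E; apply: eq_mx3; rewrite !(mxE, big_ord3) /= !(mulr0, mul0r, mulr1, addr0).
Qed.

Lemma tr_diag_block1_vec Pt (x : 'cV[R]_3) : ((diag_block1 Pt)^T *m x) 0 0 = x 0 0.
Proof. by rewrite diag_block1E !(mxE, big_ord3) /= mul1r !mul0r !addr0. Qed.

Lemma conj_tr P X : X^T = X -> (P *m X *m P^T)^T = P *m X *m P^T.
Proof. by move=> h; rewrite !trmx_mul trmxK h mulmxA. Qed.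

Lemma conjK P X : orthogonal_mx P -> P^T *m (P *m X *m P^T) *m P = X.
Proof. by move=> h; rewrite !mulmxA h mul1mx -mulmxA h mulmx1. Qed.

Lemma conjVK P X : orthogonal_mx P -> P *m (P^T *m X *m P) *m P^T = X.
Proof.
by move=> /orthogonal_mxV h; rewrite !mulmxA h mul1mx -mulmxA h mulmx1.
Qed.

Lemma mx_inner_conj2 P X Y : orthogonal_mx P ->
  mx_inner (P *m X *m P^T) (P *m Y *m P^T) = mx_inner X Y.
Proof. by move=> h; rewrite mx_inner_conj conjK. Qed.

Lemma conj_sym3 P X : orthogonal_mx P -> X^T = X ->
  exists a b c d e f, X = P *m sym3 a b c d e f *m P^T.
Proof.
move=> hP symX; have symY : (P^T *m X *m P)^T = P^T *m X *m P.
  by rewrite -{2 4}[P]trmxK; exact: conj_tr.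
by rewrite -(conjVK P X hP) (sym3E _ symY); do 6 eexists.
Qed.

Lemma quad_conj P X (x : 'cV[R]_3) :
  x^T *m (P *m X *m P^T) *m x = (P^T *m x)^T *m X *m (P^T *m x).
Proof. by rewrite trmx_mul trmxK !mulmxA. Qed.

Definition vec3 (x y z : R) : 'cV[R]_3 := \col_i nth 0 [:: x; y; z] i.

Lemma quad_sym3_vec3 a b c d e f x y z :
  ((vec3 x y z)^T *m sym3 a b c d e f *m vec3 x y z) 0 0 =
  a * x ^+ 2 + d * y ^+ 2 + f * z ^+ 2 +
  2 * (b * x * y + c * x * z + e * y * z).
Proof. by rewrite quad_sym3 !mxE. Qed.

Lemma psd_conj P X : @psd_cone R 3 X -> @psd_cone R 3 (P *m X *m P^T).
Proof.
rewrite /psd_cone /= !sym_spaceP => -[symX psdX].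
by split=> [|x]; [exact: conj_tr | rewrite quad_conj].
Qed.

Lemma psd_conjK P X : orthogonal_mx P ->
  @psd_cone R 3 (P *m X *m P^T) -> @psd_cone R 3 X.
Proof.
by move=> hP /(psd_conj P^T); rewrite trmxK conjK.
Qed.

Lemma psd_sym3 a b c d e f : @psd_cone R 3 (sym3 a b c d e f) ->
  forall x y z, 0 <= a * x ^+ 2 + d * y ^+ 2 + f * z ^+ 2 +
                     2 * (b * x * y + c * x * z + e * y * z).
Proof. by move=> [_ h] x y z; rewrite -quad_sym3_vec3. Qed.

Lemma affine_ge0_slope0 (a b : R) : (forall t, 0 <= a + b * t) -> b = 0.
Proof.
move=> h; apply/eqP/negPn/negP => b0.
(* At this [t] the affine function equals -1. *)
by have := h (- (a + 1) / b); rewrite mulrC divfK //; lra.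
Qed.

(** If a diagonal entry is 0, the form is affine in the corresponding coordinate, and its slope,
    twice an off-diagonal entry at the chosen test vectors, must vanish. *)
Lemma psd_sym3_diag a b c d e f : @psd_cone R 3 (sym3 a b c d e f) ->
  [/\ 0 <= d, 0 <= f, d = 0 -> b = 0 & f = 0 -> c = 0 /\ e = 0].
Proof.
move=> /psd_sym3 h; split.
- by have := h 0 1 0; lra.
- by have := h 0 0 1; lra.
- move=> d0; suff : 2 * b = 0 by lra.
  by apply: (@affine_ge0_slope0 a) => t; have := h 1 t 0; rewrite d0; lra.
- move=> f0; split.
  + suff : 2 * c = 0 by lra.
    by apply: (@affine_ge0_slope0 a) => t; have := h 1 0 t; rewrite f0; lra.
  + suff : 2 * e = 0 by lra.
    by apply: (@affine_ge0_slope0 d) => t; have := h 0 1 t; rewrite f0; lra.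
Qed.

Lemma psd_Ustar : @psd_cone R 3 (Ustar R).
Proof.
split=> [|x]; first by apply/sym_spaceP; exact: sym3_tr.
by rewrite quad_sym3; have := sqr_ge0 (x 0 0); lra.
Qed.

(* Feasible directions of the cone at [Ustar]: the quadratic form of [v] may
   be negative only to the extent that the (0,0) entry can absorb it. *)
Lemma psd_Ustar_add (v : 'M[R]_3) k : v^T = v ->
    (forall x : 'cV[R]_3, - k * x 0 0 ^+ 2 <= (x^T *m v *m x) 0 0) ->
  exists2 t, 0 < t & @psd_cone R 3 (Ustar R + t *: v).
Proof.
move=> symv hv; have k0 : 0 < 1 + `|k| by rewrite ltr_pwDl.
(* Since [t + t |k| = 1], the unit corner of [Ustar] absorbs the possible deficit [t |k| x_0^2]. *)
set t := (1 + `|k|)^-1; have t0 : 0 < t by rewrite invr_gt0.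
have tk : t * (1 + `|k|) = 1 by rewrite mulVf ?gt_eqF.
exists t => //; split=> [|x].
  by apply/sym_spaceP; rewrite linearD linearZ /= symv Ustar_sym3 sym3_tr.
rewrite mulmxDr mulmxDl -scalemxAr -scalemxAl [_ 0 0]mxE.
rewrite Ustar_sym3 quad_sym3 [X in _ + X]mxE.
have h1 : 0 <= t * ((x^T *m v *m x) 0 0 + `|k| * x 0 0 ^+ 2).
  apply: mulr_ge0; first exact: ltW.
  have := hv x; have := ler_wpM2r (sqr_ge0 (x 0 0)) (ler_norm k); lra.
have h2 := mulr_ge0 (ltW t0) (sqr_ge0 (x 0 0)).
have h3 : x 0 0 ^+ 2 = t * x 0 0 ^+ 2 + t * `|k| * x 0 0 ^+ 2.
  by rewrite -[LHS]mul1r -{1}tk; ring.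
lra.
Qed.

End Conjugation.

(** * Directions at [Ustar] and the construction of [A_3] *)

Section Directions.
Context {R : realType}.
Implicit Types (X Y : 'M[R]_3) (V : {vspace 'M[R]_3}) (P : 'M[R]_3).

(** Passes from three equations to a base point plus a direction space, the form that
    [affine_subspace_dim] asks for. *)
Lemma affine_set_orthogonal3 (A1 A2 A3 J : 'M[R]_3) :
    A2^T = A2 -> J^T = J -> A2 <> 0 ->
    [/\ mx_inner A1 (Ustar R) = 1, mx_inner A2 (Ustar R) = 0
      & mx_inner A3 (Ustar R) = 0] ->
    [/\ mx_inner A1 J = 0, mx_inner A2 J = 0 & mx_inner A3 J = 1] ->
  exists K : {vspace 'M[R]_3}, [/\ \dim K = 3,
    forall X, X \in K <-> [/\ X^T = X, mx_inner A1 X = 0, mx_inner A2 X = 0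
                           & mx_inner A3 X = 0]
    & [set X | [/\ sym_space X, mx_inner A1 X = 1,
                   mx_inner A2 X = 0 & mx_inner A3 X = 0]] =
      [set Ustar R + v | v in [set` K]]].
Proof.
move=> symA2 symJ A20 hU hJ; have symU := sym3_tr 1 0 0 0 0 (0 : R).
have [K dimK KP] := dim_orthogonal3 A1 A2 A3 _ J symA2 symU symJ A20 hU hJ.
case: hU => u1 u2 u3; exists K; split=> //; apply/seteqP; split=> X /=.
  move=> [/sym_spaceP symX x1 x2 x3].
  exists (X - Ustar R); last by rewrite addrC subrK.
  apply/KP; rewrite [_^T]linearB /= symX symU !linearB /=.
  by rewrite x1 x2 x3 u1 u2 u3 !subrr.
move=> [v /KP [symv v1 v2 v3] <-].
split; [apply/sym_spaceP|..]; rewrite ?[_^T]linearD /= ?symv ?symU ?linearD /= ?(u1, u2, u3, v1, v2, v3) ?addr0 //.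
Qed.

(** The bound says that adding [k] times the corner unit matrix to [v] makes its form nonnegative.
    By [psd_Ustar_add] a nonzero symmetric [v] of this kind would lead from [Ustar] to further
    points of the cone. *)
Definition no_feasible_direction (V : {vspace 'M[R]_3}) :=
  forall v k, v \in V ->
    (forall x : 'cV[R]_3, - k * x 0 0 ^+ 2 <= (x^T *m v *m x) 0 0) -> v = 0.

(** The positive definite lower block dominates [m (y^2 + z^2)], where [m] is its determinant over
    its trace; completing squares then absorbs the cross terms with [x] at a cost proportional to
    [x^2]. *)
Lemma sym3_psd2_form v0 v1 v2 d e f :
    0 < d + f -> e ^+ 2 < d * f ->
  exists k, forall x y z : R,
    - k * x ^+ 2 <= v0 * x ^+ 2 + d * y ^+ 2 + f * z ^+ 2 +
                  2 * (v1 * x * y + v2 * x * z + e * y * z).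
Proof.
move=> tr_gt0 det_gt0; pose m := (d * f - e ^+ 2) / (d + f).
have m0 : 0 < m by rewrite divr_gt0 ?subr_gt0.
have hm y z : m * (y ^+ 2 + z ^+ 2) <= d * y ^+ 2 + f * z ^+ 2 + 2 * e * y * z.
  rewrite -subr_ge0 -(pmulr_rge0 _ tr_gt0).
  (* Cayley-Hamilton for the block [M]: [tr(M) M - det(M) I = M^2], whose form is the squared norm
     of [M (y, z)]. *)
  have -> : (d + f) * (d * y ^+ 2 + f * z ^+ 2 + 2 * e * y * z - m * (y ^+ 2 + z ^+ 2))
     = (d * y + e * z) ^+ 2 + (e * y + f * z) ^+ 2.
    by rewrite /m; field; rewrite gt_eqF.
  by rewrite addr_ge0 ?sqr_ge0.
have hs x y b : - (b ^+ 2 / m) * x ^+ 2 <= m * y ^+ 2 + 2 * b * x * y.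
  rewrite -subr_ge0.
  have -> : m * y ^+ 2 + 2 * b * x * y - - (b ^+ 2 / m) * x ^+ 2
     = m * (y + b * x / m) ^+ 2 by field; rewrite gt_eqF.
  by rewrite mulr_ge0 ?sqr_ge0 ?ltW.
exists (- v0 + v1 ^+ 2 / m + v2 ^+ 2 / m) => x y z.
by have := hm y z; have := hs x y v1; have := hs x z v2; lra.
Qed.

(** The two inequalities express that the lower block is nonzero and positive semidefinite; rotated,
    it becomes a positive multiple of [A_3]. *)
Lemma psd2_orthogonal V : (forall v, v \in V -> v^T = v) ->
    no_feasible_direction V ->
  exists p q r, [/\ 0 < p + r, q ^+ 2 <= p * r &
    forall v, v \in V -> mx_inner (sym3 0 0 0 p q r) v = 0].
Proof.
move=> symV feasV.
pose e0 : 'M[R]_3 := sym3 1 0 0 0 0 0; pose e1 : 'M[R]_3 := sym3 0 1 0 0 0 0.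
pose e2 : 'M[R]_3 := sym3 0 0 1 0 0 0.
have [_ /memv_addP [v Vv [_ /memv_addP [_ /vlineP [a ->] [_ /memv_addP
  [_ /vlineP [b ->] [_ /vlineP [c ->] ->]] ->]] ->]] hB] :=
  vspace_projection (V + (<[e0]> + (<[e1]> + <[e2]>)))%VS (sym3 0 0 0 1 0 1).
have VW w : w \in V -> w \in (V + (<[e0]> + (<[e1]> + <[e2]>)))%VS.
  by apply/subvP/addvSl.
have [We0 We1 We2] : [/\ e0 \in (V + (<[e0]> + (<[e1]> + <[e2]>)))%VS,
    e1 \in (V + (<[e0]> + (<[e1]> + <[e2]>)))%VS
  & e2 \in (V + (<[e0]> + (<[e1]> + <[e2]>)))%VS].
  split; rewrite memvE; apply: subv_trans (addvSr _ _).
  - exact: addvSl.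
  - by apply: subv_trans (addvSr _ _); exact: addvSl.
  - by apply: subv_trans (addvSr _ _); exact: addvSr.
move: hB; set B := (_ - _) => hB.
have vE := sym3E v (symV v Vv).
move: (v 0 0) (v 0 1) (v 0 2) (v 1 1) (v 1 2) (v 2 2) vE => v0 v1 v2 d e f vE.
have BE : B = sym3 (- v0 - a) (- v1 - b) (- v2 - c) (1 - d) (- e) (1 - f).
  by rewrite /B vE; apply: eq_mx3; rewrite !mxE /=; split; ring.
(* Orthogonality to [e0], [e1], [e2] clears row and column 0 of [B]; orthogonality to [v] then gives
   [d + f = d^2 + 2 e^2 + f^2]. *)
have [b0 b1 b2] := And3 (hB _ We0) (hB _ We1) (hB _ We2).
have bv := hB _ (VW _ Vv).
rewrite BE !mx_inner_sym3 in b0 b1 b2.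
have BE' : B = sym3 0 0 0 (1 - d) (- e) (1 - f).
  by rewrite BE; congr sym3; lra.
rewrite BE' vE mx_inner_sym3 in bv.
have df1 : d + f <= 1.
  rewrite leNgt; apply/negP => df1.
  have det_gt0 : e ^+ 2 < d * f.
    (* By the relation [bv], this product is [2 (d f - e^2)]. *)
    suff : 0 < (d + f) * (d + f - 1) by lra.
    by apply: mulr_gt0; lra.
  have df0 : 0 < d + f by lra.
  have [k hk] := sym3_psd2_form v0 v1 v2 d e f df0 det_gt0.
  have /matrixP v00 : v = 0.
    by apply: (feasV _ k Vv) => x; rewrite vE quad_sym3; have := hk (x 0 0) (x 1 0) (x 2 0).
  have := v00 1 1; have := v00 2 2; rewrite vE !mxE /= => f0 d0.
  by move: df1; rewrite f0 d0; lra.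
exists (1 - d), (- e), (1 - f); split; first by lra.
(* By [bv] again, this product is twice the determinant of the lower block of [B]. *)
- suff : 0 <= (1 - (d + f)) * (2 - (d + f)) by lra.
  by apply: mulr_ge0; lra.
- by move=> w /VW /hB; rewrite mx_innerC BE' mx_innerC.
Qed.

(** The bound [l <= p + r] makes the other eigenvalue nonnegative. The eigenvector [(q, l - p)] is
    nonzero when [q] is; the diagonal case is treated directly. *)
Lemma sym2_top_eigenvector (p q r : R) : 0 < p + r -> q ^+ 2 <= p * r ->
  exists x y l, [/\ x ^+ 2 + y ^+ 2 = 1, 0 < l, l <= p + r,
    p * x + q * y = l * x & q * x + r * y = l * y].
Proof.
move=> tr_gt0 det_ge0; have [q0|q0] := eqVneq q 0.
  rewrite {}q0 in det_ge0 *; have [rp|pr] := leP r p.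
    have r0 : 0 <= r by have p0 : 0 < p; [lra|rewrite -(pmulr_rge0 _ p0); lra].
    by exists 1, 0, p; split; lra.
  have p0 : 0 <= p by have r0 : 0 < r; [lra|rewrite -(pmulr_lge0 _ r0); lra].
  by exists 0, 1, r; split; lra.
pose s := Num.sqrt ((p - r) ^+ 2 + 4 * q ^+ 2); pose l := (p + r + s) / 2.
have s2 : s ^+ 2 = (p - r) ^+ 2 + 4 * q ^+ 2.
  by rewrite sqr_sqrtr //; have := sqr_ge0 (p - r); have := sqr_ge0 q; lra.
have s0 : 0 <= s by exact: sqrtr_ge0.
(* [s^2 - (p + r)^2 = 4 (q^2 - p r)] is nonpositive. *)
have sle : s <= p + r.
  rewrite leNgt; apply/negP => lt_s.
  have : 0 < (s - (p + r)) * (s + (p + r)) by rewrite mulr_gt0; lra.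
  by rewrite -subr_sqr s2; lra.
have char_eq : l ^+ 2 = (p + r) * l - (p * r - q ^+ 2).
  suff : 4 * l ^+ 2 = 4 * ((p + r) * l - (p * r - q ^+ 2)) by lra.
  have -> : 4 * l ^+ 2 = (p + r) ^+ 2 + 2 * (p + r) * s + s ^+ 2 by rewrite /l; field.
  by rewrite s2 /l; field.
pose m := q ^+ 2 + (l - p) ^+ 2; pose n := Num.sqrt m.
have m0 : 0 < m by rewrite ltr_pwDl ?sqr_ge0 // exprn_even_gt0.
have n0 : 0 < n by rewrite sqrtr_gt0.
have n2 : n ^+ 2 = m by rewrite sqr_sqrtr ?ltW.
exists (q / n), ((l - p) / n), l; split.
- by rewrite !expr_div_n -mulrDl n2 divff ?gt_eqF.
- by rewrite /l; lra.
- by rewrite /l; lra.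
- by field; rewrite gt_eqF.
- rewrite !mulrA -!mulrDl; congr (_ / _); lra.
Qed.

(** The top eigenvector [(x, y)] is the second column of [Pt], so that factoring out [l] leaves 1 in
    the last diagonal entry and the ratio [mu] of the eigenvalues before it. *)
Lemma sym2_diagonalization (p q r : R) : 0 < p + r -> q ^+ 2 <= p * r ->
  exists (Pt : 'M[R]_2) l mu, [/\ orthogonal_mx Pt, 0 < l, 0 <= mu &
    sym3 0 0 0 p q r =
    l *: (diag_block1 Pt *m sym3 0 0 0 mu 0 1 *m (diag_block1 Pt)^T)].
Proof.
move=> tr_gt0 det_ge0.
have [x [y [l [xy1 l0 ltr e1 e2]]]] := sym2_top_eigenvector p q r tr_gt0 det_ge0.
pose Pt : 'M[R]_2 :=
  \matrix_(i, j) nth 0 (nth [::] [:: [:: y; x]; [:: - x; y]] i) j.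
exists Pt, l, ((p + r - l) / l); split=> //.
- apply/matrixP => i j; rewrite !mxE !big_ord_recl big_ord0 !mxE /=.
  by case: i => [[|[|//]] ?]; case: j => [[|[|//]] ?] /=; lra.
- by apply: divr_ge0; [rewrite subr_ge0|exact: ltW].
(* The eigenvector equations multiplied by [x] and [y], together with [x^2 + y^2 = 1] in the form
   [xyE], make the entrywise goals linear in the monomials. *)
have f1 : x * (p * x + q * y) = x * (l * x) by rewrite e1.
have f2 : y * (q * x + r * y) = y * (l * y) by rewrite e2.
have f3 : y * (p * x + q * y) = y * (l * x) by rewrite e1.
have f4 : x * (q * x + r * y) = x * (l * y) by rewrite e2.
have xyE z : z = z * x ^+ 2 + z * y ^+ 2 by rewrite -mulrDr xy1 mulr1.
have muE a b : l * (a * ((p + r - l) / l) * b) = (p + r - l) * a * b.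
  by field; rewrite gt_eqF.
have [pE qE rE] := And3 (xyE p) (xyE q) (xyE r).
rewrite diag_block1E; apply: eq_mx3; rewrite !(mxE, big_ord3) /=;
  split; rewrite ?(mulr0, mul0r, mulr1, addr0, add0r, mul1r) //.
all: by rewrite mulrDr muE; lra.
Qed.

End Directions.

(** * Construction of [A_1] and [A_2] *)

Section Equations.
Context {R : realType}.
Implicit Types (X Y : 'M[R]_3) (V : {vspace 'M[R]_3}) (P : 'M[R]_3).

Let U := Ustar R.

Lemma conj_scaleD P a X Y :
  P *m Y *m P^T + a *: (P *m X *m P^T) = P *m (Y + a *: X) *m P^T.
Proof. by rewrite scalemxAl scalemxAr -mulmxDl -mulmxDr. Qed.

Lemma Ustar_feasible V : no_feasible_direction V -> U \notin V.
Proof.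
move=> feasV; apply/negP => UV; have /matrixP/(_ 0 0) : U = 0.
  apply: (feasV _ 0 UV) => x; rewrite /U Ustar_sym3 quad_sym3.
  by have := sqr_ge0 (x 0 0); lra.
by rewrite !mxE => /eqP; rewrite oner_eq0.
Qed.

(** [P^T] preserves coordinate 0, so the bound [- k x_0^2] is the same before and after
    conjugation. *)
Lemma conj_feasible V P y k : orthogonal_mx P ->
    (forall x : 'cV[R]_3, (P^T *m x) 0 0 = x 0 0) ->
    no_feasible_direction V -> P *m y *m P^T \in V ->
    (forall x : 'cV[R]_3, - k * x 0 0 ^+ 2 <= (x^T *m y *m x) 0 0) -> y = 0.
Proof.
move=> hP P00 feasV yV hk; rewrite -(conjK P y hP).
rewrite (feasV _ k yV) ?mulmx0 ?mul0mx // => x.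
by rewrite -P00 quad_conj.
Qed.

(* In the coordinates given by [P], type 1 and type 2 correspond to [0 < mu]
   and [mu = 0]. *)
Lemma equations_type1 V Pt mu :
    let P := diag_block1 Pt in
    let A3 := P *m sym3 0 0 0 mu 0 1 *m P^T in
    orthogonal_mx Pt -> (forall v, v \in V -> v^T = v) -> \dim V = 3 ->
    no_feasible_direction V ->
    (forall v, v \in V -> mx_inner A3 v = 0) ->
  exists c1 c2 c3 c4 c5 c6 c7 c8,
    let A1 := P *m sym3 1 c1 c2 c3 c4 0 *m P^T in
    let A2 := P *m sym3 0 c5 c6 c7 c8 0 *m P^T in
    [/\ A2 <> 0, forall v, v \in V -> mx_inner A1 v = 0
      & forall v, v \in V -> mx_inner A2 v = 0].
Proof.
move=> P A3 hPt symV dimV feasV A3V.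
have hP : orthogonal_mx P := orthogonal_diag_block1 Pt hPt.
have PU : P *m sym3 1 0 0 0 0 0 *m P^T = U := diag_block1_Ustar Pt.
pose J := P *m sym3 0 0 0 0 0 1 *m P^T.
have symU : U^T = U by exact: sym3_tr.
have symJ : J^T = J by apply: conj_tr; exact: sym3_tr.
have A3U : mx_inner A3 U = 0 by rewrite -PU mx_inner_conj2 // mx_inner_sym3; lra.
have A3J : mx_inner A3 J = 1 by rewrite mx_inner_conj2 // mx_inner_sym3; lra.
have symJV X : X \in (V + <[J]>)%VS -> X^T = X.
  by move=> /memv_addP [v /symV sv [_ /vlineP [k ->] ->]];
    rewrite linearD linearZ /= sv symJ.
(* Pairing with [A3] shows that the coefficient of [J] would be 0, so [U] would lie in [V]. *)
have UVJ : U \notin (V + <[J]>)%VS.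
  apply/negP => /memv_addP [v vV [_ /vlineP [k ->] UE]].
  have : mx_inner A3 U = k by rewrite UE linearD linearZ /= A3V // A3J mulr1 add0r.
  rewrite A3U => k0; move: UE; rewrite -k0 scale0r addr0 => UE.
  by have := Ustar_feasible V feasV; rewrite UE vV.
(* In the coordinates of [P], orthogonality to [J] clears the last diagonal entry of [A1], and the
   pairing with [U] makes its corner 1. *)
have [A1 [symA1 A1V A1U]] := vspace_separation _ U symJV symU UVJ.
(* The enlarged space has dimension at most 5, below 6. Any symmetric [X] outside it yields a
   nonzero [A2], with corner 0 because [U] was added. *)
have [X symX XW] : exists2 X, X^T = X & X \notin (V + <[J]> + <[U]>)%VS.
  have /subvPn [X /symvP symX XW] : ~~ (@symv R <= V + <[J]> + <[U]>)%VS.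
    apply/negP => /dimvS; rewrite dim_symv leqNgt => /negP; apply.
    apply: leq_ltn_trans (dimv_add_leqif _ _).1 _.
    apply: leq_ltn_trans (leq_add (dimv_add_leqif _ _).1 (leqnn _)) _.
    by rewrite dimV !dim_vline; do 2 case: (_ != 0).
  by exists X.
have symW Y : Y \in (V + <[J]> + <[U]>)%VS -> Y^T = Y.
  by move=> /memv_addP [v /symJV sv [_ /vlineP [k ->] ->]];
    rewrite linearD linearZ /= sv symU.
have [A2 [symA2 A2W A2X]] := vspace_separation _ X symW symX XW.
have A1J : mx_inner A1 J = 0 by apply: A1V; rewrite memvE addvSr.
have A2J : mx_inner A2 J = 0.
  by apply: A2W; rewrite memvE; apply: subv_trans (addvSl _ _); exact: addvSr.
have A2U : mx_inner A2 U = 0 by apply: A2W; rewrite memvE addvSr.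
have {}A1V v : v \in V -> mx_inner A1 v = 0.
  by move=> vV; apply: A1V; move: v vV; apply/subvP/addvSl.
have {}A2W v : v \in V -> mx_inner A2 v = 0.
  move=> vV; apply: A2W; move: v vV; apply/subvP.
  by apply: subv_trans (addvSl _ _); exact: addvSl.
have A20 : A2 <> 0.
  by move=> A20; have := A2X; rewrite A20 mx_innerC linear0 => /eqP; rewrite eq_sym oner_eq0.
have [a1 [b1 [c1 [d1 [e1 [f1 E1]]]]]] := conj_sym3 P A1 hP symA1.
have [a2 [b2 [c2 [d2 [e2 [f2 E2]]]]]] := conj_sym3 P A2 hP symA2.
rewrite E1 -?PU ?/J !mx_inner_conj2 // !mx_inner_sym3 in A1U A1J.
rewrite E2 -?PU ?/J !mx_inner_conj2 // !mx_inner_sym3 in A2U A2J.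
exists b1, c1, d1, e1, b2, c2, d2, e2 => /=.
have -> : sym3 1 b1 c1 d1 e1 0 = sym3 a1 b1 c1 d1 e1 f1 by congr sym3; lra.
have -> : sym3 0 b2 c2 d2 e2 0 = sym3 a2 b2 c2 d2 e2 f2 by congr sym3; lra.
by rewrite -E1 -E2.
Qed.

(** Here [A3] is [J]. [A1] separates [U] from [V] enlarged by [J] and [D]; [A2] separates [D] from
    [V] enlarged by [J], [U] and [B]. Each added matrix prescribes a zero entry. *)
Lemma equations_type2 V Pt :
    let P := diag_block1 Pt in
    let A3 := P *m sym3 0 0 0 0 0 1 *m P^T in
    orthogonal_mx Pt -> (forall v, v \in V -> v^T = v) ->
    no_feasible_direction V ->
    (forall v, v \in V -> mx_inner A3 v = 0) ->
  exists c1 c2 c3 c4 c5,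
    let A1 := P *m sym3 1 c1 c2 0 c3 0 *m P^T in
    let A2 := P *m sym3 0 0 c4 1 c5 0 *m P^T in
    (forall v, v \in V -> mx_inner A1 v = 0) /\
    (forall v, v \in V -> mx_inner A2 v = 0).
Proof.
move=> P J hPt symV feasV JV.
have hP : orthogonal_mx P := orthogonal_diag_block1 Pt hPt.
have PU : P *m sym3 1 0 0 0 0 0 *m P^T = U := diag_block1_Ustar Pt.
have P00 : forall x : 'cV[R]_3, (P^T *m x) 0 0 = x 0 0 := tr_diag_block1_vec Pt.
pose D := P *m sym3 0 0 0 1 0 0 *m P^T.
pose B := P *m sym3 0 1 0 0 0 0 *m P^T.
have symU : U^T = U by exact: sym3_tr.
have symJ : J^T = J by apply: conj_tr; exact: sym3_tr.
have symD : D^T = D by apply: conj_tr; exact: sym3_tr.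
have symB : B^T = B by apply: conj_tr; exact: sym3_tr.
have JU : mx_inner J U = 0 by rewrite -PU mx_inner_conj2 // mx_inner_sym3; lra.
have JJ : mx_inner J J = 1 by rewrite mx_inner_conj2 // mx_inner_sym3; lra.
have JD : mx_inner J D = 0 by rewrite mx_inner_conj2 // mx_inner_sym3; lra.
have JB : mx_inner J B = 0 by rewrite mx_inner_conj2 // mx_inner_sym3; lra.
have symJV X : X \in (V + <[J]>)%VS -> X^T = X.
  by move=> /memv_addP [v /symV sv [_ /vlineP [k ->] ->]];
    rewrite linearD linearZ /= sv symJ.
have symW1 X : X \in (V + <[J]> + <[D]>)%VS -> X^T = X.
  by move=> /memv_addP [v /symJV sv [_ /vlineP [k ->] ->]];
    rewrite linearD linearZ /= sv symD.
have symW2 X : X \in (V + <[J]> + <[U]> + <[B]>)%VS -> X^T = X.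
  move=> /memv_addP [_ /memv_addP [v /symJV sv [_ /vlineP [k ->] ->]] [_ /vlineP [l ->] ->]].
  by rewrite !linearD !linearZ /= sv symU symB.
(* Pairing with [J] removes the [J] term, so [V] would contain a conjugate of [diag(1, -b, 0)].
   According to the sign of [b], this matrix or its negative is a feasible direction. *)
have UW1 : U \notin (V + <[J]> + <[D]>)%VS.
  apply/negP => /memv_addP [_ /memv_addP [v vV [_ /vlineP [k ->] ->]] [_ /vlineP [b ->] UE]].
  have : mx_inner J U = k.
    by rewrite UE !linearD !linearZ /= JV // JJ JD mulr1 mulr0 add0r addr0.
  rewrite JU => k0; move: UE; rewrite -k0 scale0r addr0 => UE.
  have vE : v = P *m sym3 1 0 0 (- b) 0 0 *m P^T.
    apply: (addIr (b *: D)); rewrite -UE -PU conj_scaleD.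
    by congr (_ *m _ *m _); apply: eq_mx3; rewrite !mxE /=; split; ring.
  have [b0|b0] := leP b 0.
    have : sym3 1 0 0 (- b) 0 0 = 0.
      apply: (conj_feasible V P _ 0 hP P00 feasV); rewrite -?vE // => x.
      rewrite quad_sym3; have := sqr_ge0 (x 0 0).
      by have : 0 <= - b * x 1 0 ^+ 2; [rewrite mulr_ge0 ?sqr_ge0 ?oppr_ge0|lra].
    by move=> /matrixP/(_ 0 0); rewrite !mxE /= => /eqP; rewrite oner_eq0.
  have : - sym3 1 0 0 (- b) 0 0 = 0.
    apply: (conj_feasible V P _ 1 hP P00 feasV).
      by rewrite mulmxN mulNmx -vE rpredN.
    move=> x; rewrite mulmxN mulNmx mxE quad_sym3.
    by have : 0 <= b * x 1 0 ^+ 2; [rewrite mulr_ge0 ?sqr_ge0 ?ltW|lra].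
  by move=> /matrixP/(_ 0 0); rewrite !mxE /= => /eqP; rewrite oppr_eq0 oner_eq0.
have DW2 : D \notin (V + <[J]> + <[U]> + <[B]>)%VS.
  apply/negP => /memv_addP [_ /memv_addP [_ /memv_addP [v vV [_ /vlineP [k ->] ->]]
    [_ /vlineP [a ->] ->]] [_ /vlineP [b ->] DE]].
  have : mx_inner J D = k.
    by rewrite DE !linearD !linearZ /= JV // JJ JU JB mulr1 !mulr0 add0r !addr0.
  rewrite JD => k0; move: DE; rewrite -k0 scale0r addr0 => DE.
  have vE : v = P *m sym3 (- a) (- b) 0 1 0 0 *m P^T.
    apply: (addIr (a *: U)); apply: (addIr (b *: B)); rewrite -DE -PU !conj_scaleD.
    by congr (_ *m _ *m _); apply: eq_mx3; rewrite !mxE /=; split; ring.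
  have : sym3 (- a) (- b) 0 1 0 0 = 0.
    (* The form is [(x_1 - b x_0)^2 - (a + b^2) x_0^2]. *)
    apply: (conj_feasible V P _ (a + b ^+ 2) hP P00 feasV); rewrite -?vE // => x.
    by rewrite quad_sym3; have := sqr_ge0 (x 1 0 - b * x 0 0); lra.
  by move=> /matrixP/(_ 1 1); rewrite !mxE /= => /eqP; rewrite oner_eq0.
have [A1 [symA1 A1W A1U]] := vspace_separation _ U symW1 symU UW1.
have [A2 [symA2 A2W A2D]] := vspace_separation _ D symW2 symD DW2.
have VJ : (V <= V + <[J]>)%VS by exact: addvSl.
have JVJ : (<[J]> <= V + <[J]>)%VS by exact: addvSr.
have W1 : (V + <[J]> <= V + <[J]> + <[D]>)%VS by exact: addvSl.
have W2 : (V + <[J]> + <[U]> <= V + <[J]> + <[U]> + <[B]>)%VS by exact: addvSl.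
have W2' : (V + <[J]> <= V + <[J]> + <[U]> + <[B]>)%VS.
  by apply: subv_trans W2; exact: addvSl.
have A1J : mx_inner A1 J = 0 by apply: A1W; rewrite memvE (subv_trans JVJ).
have A2J : mx_inner A2 J = 0 by apply: A2W; rewrite memvE (subv_trans JVJ).
have A1D : mx_inner A1 D = 0 by apply: A1W; rewrite memvE addvSr.
have A2B : mx_inner A2 B = 0 by apply: A2W; rewrite memvE addvSr.
have A2U : mx_inner A2 U = 0.
  by apply: A2W; rewrite memvE (subv_trans _ W2) // addvSr.
have {}A1W v : v \in V -> mx_inner A1 v = 0.
  by rewrite memvE => vV; apply: A1W; rewrite memvE (subv_trans vV) ?(subv_trans VJ).
have {}A2W v : v \in V -> mx_inner A2 v = 0.
  by rewrite memvE => vV; apply: A2W; rewrite memvE (subv_trans vV) ?(subv_trans VJ).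
have [a1 [b1 [c1 [d1 [e1 [f1 E1]]]]]] := conj_sym3 P A1 hP symA1.
have [a2 [b2 [c2 [d2 [e2 [f2 E2]]]]]] := conj_sym3 P A2 hP symA2.
rewrite E1 -?PU ?/J ?/D !mx_inner_conj2 // !mx_inner_sym3 in A1U A1J A1D.
rewrite E2 -?PU ?/J ?/D ?/B !mx_inner_conj2 // !mx_inner_sym3 in A2U A2J A2D A2B.
exists b1, c1, e1, c2, e2 => /=.
have -> : sym3 1 b1 c1 0 e1 0 = sym3 a1 b1 c1 d1 e1 f1 by congr sym3; lra.
have -> : sym3 0 0 c2 1 e2 0 = sym3 a2 b2 c2 d2 e2 f2 by congr sym3; lra.
by rewrite -E1 -E2.
Qed.

End Equations.

(** * The affine subspace cut out by the three equations *)

Section Slices.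
Context {R : realType}.
Context (Pt : 'M[R]_2) (b1 c1 d1 e1 b2 c2 d2 e2 mu : R).
Context (orth_Pt : orthogonal_mx Pt).
Let P := diag_block1 Pt.
Let A1 := P *m sym3 1 b1 c1 d1 e1 0 *m P^T.
Let A2 := P *m sym3 0 b2 c2 d2 e2 0 *m P^T.
Let A3 := P *m sym3 0 0 0 mu 0 1 *m P^T.
Context (A2_neq0 : A2 <> 0).
(** Covers both types: type 2 is the case [d1 = b2 = mu = 0] and [d2 = 1]. *)
Let slice := [set X | [/\ sym_space X, mx_inner A1 X = 1,
                          mx_inner A2 X = 0 & mx_inner A3 X = 0]].

Let orth_P : orthogonal_mx P. Proof. exact: orthogonal_diag_block1. Qed.

Let pairing_Ustar : [/\ mx_inner A1 (Ustar R) = 1, mx_inner A2 (Ustar R) = 0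
                      & mx_inner A3 (Ustar R) = 0].
Proof.
rewrite -(diag_block1_Ustar Pt) Ustar_sym3 !mx_inner_conj2 // !mx_inner_sym3.
by split; lra.
Qed.

Let slice_vspace : exists K : {vspace 'M[R]_3}, [/\ \dim K = 3,
    forall X, X \in K <-> [/\ X^T = X, mx_inner A1 X = 0, mx_inner A2 X = 0
                           & mx_inner A3 X = 0]
    & slice = [set Ustar R + v | v in [set` K]]].
Proof.
apply: (affine_set_orthogonal3 A1 A2 A3 (P *m sym3 0 0 0 0 0 1 *m P^T)) => //.
- by apply: conj_tr; exact: sym3_tr.
- by apply: conj_tr; exact: sym3_tr.
- by rewrite !mx_inner_conj2 // !mx_inner_sym3; split; lra.
Qed.

Lemma slice_dim3 : affine_subspace_dim 3 slice.
Proof.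
have [K [dimK KP ->]] := slice_vspace.
exists (Ustar R), K; split=> //.
  by apply/sym_spaceP; exact: sym3_tr.
by move=> X /KP [symX _ _ _]; apply/sym_spaceP.
Qed.

Lemma slice_eq_translate (V : {vspace 'M[R]_3}) :
    \dim V = 3 -> (forall v, v \in V -> v^T = v) ->
    (forall v, v \in V -> mx_inner A1 v = 0) ->
    (forall v, v \in V -> mx_inner A2 v = 0) ->
    (forall v, v \in V -> mx_inner A3 v = 0) ->
  [set Ustar R + v | v in [set` V]] = slice.
Proof.
move=> dimV symV A1V A2V A3V; have [K [dimK KP ->]] := slice_vspace.
suff -> : V = K by [].
apply/eqP; rewrite eqEdim dimV dimK andbT; apply/subvP => v vV.
by apply/KP; split; [exact: symV|exact: A1V|exact: A2V|exact: A3V].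
Qed.

(** The type-dependent part is isolated in the premise, in the coordinates of [P]: the equations of
    [A2] and [A3] must leave only the corner, which [A1] then sets to 1. *)
Lemma psd_slice :
    (forall a b c d e f, @psd_cone R 3 (sym3 a b c d e f) ->
       d2 * d + 2 * (b2 * b + c2 * c + e2 * e) = 0 -> mu * d + f = 0 ->
       [/\ b = 0, c = 0, d = 0, e = 0 & f = 0]) ->
  @psd_cone R 3 `&` slice = [set Ustar R].
Proof.
move=> h; apply/seteqP; split=> X /=; last first.
  move=> ->; split; first exact: psd_Ustar.
  by case: pairing_Ustar => u1 u2 u3; split=> //; case: (@psd_Ustar R).
move=> [psdX [/sym_spaceP symX x1 x2 x3]].
have [a [b [c [d [e [f XE]]]]]] := conj_sym3 P X orth_P symX.
rewrite XE !mx_inner_conj2 // !mx_inner_sym3 in x1 x2 x3.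
rewrite XE in psdX.
have psdY := psd_conjK _ _ orth_P psdX.
have [b0 c0 d0 e0 f0] : [/\ b = 0, c = 0, d = 0, e = 0 & f = 0].
  by apply: (h _ _ _ _ _ _ psdY); lra.
have a1 : a = 1 by move: x1; rewrite b0 c0 d0 e0 f0; lra.
by rewrite XE a1 b0 c0 d0 e0 f0 -Ustar_sym3; exact: diag_block1_Ustar.
Qed.

End Slices.

(** The nonnegative numbers [mu d] and [f] have sum 0, so both vanish, and zero diagonal entries
    clear their rows. *)
Lemma psd_sym3_pos_diag (R : realType) (a b c d e f mu : R) :
    0 < mu -> @psd_cone R 3 (sym3 a b c d e f) -> mu * d + f = 0 ->
  [/\ b = 0, c = 0, d = 0, e = 0 & f = 0].
Proof.
move=> mu0 /psd_sym3_diag [dge0 fge0 db fce] h.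
have mud := mulr_ge0 (ltW mu0) dge0.
have f0 : f = 0 by lra.
have d0 : d = 0.
  have /eqP : mu * d = 0 by lra.
  by rewrite mulf_eq0 gt_eqF //= => /eqP.
by have [c0 e0] := fce f0; split=> //; exact: db.
Qed.

(** * The two implications, from the equations first *)

Theorem proposition5p1 (R : realType) (E : set 'M[R]_3)
    (hE : affine_subspace E) :
  (@psd_cone R 3 `&` E = [set Ustar R] /\ affine_subspace_dim 3 E)
  <->
  (exists (c1 c2 c3 c4 c5 c6 c7 c8 : R) (Pt : 'M[R]_2),
    orthogonal_mx Pt /\
    exists A1 A2 A3 : 'M[R]_3,
      (type1 c1 c2 c3 c4 c5 c6 c7 c8 (diag_block1 Pt) A1 A2 A3 \/
       type2 c1 c2 c3 c4 c5 (diag_block1 Pt) A1 A2 A3) /\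
      E = [set X | [/\ sym_space X, mx_inner A1 X = 1,
                       mx_inner A2 X = 0 & mx_inner A3 X = 0]]).
Proof.
have type2_neq0 (Pt : 'M[R]_2) c e : orthogonal_mx Pt ->
    diag_block1 Pt *m sym3 0 0 c 1 e 0 *m (diag_block1 Pt)^T <> 0.
  move=> /orthogonal_diag_block1 hP A20.
  have := conjK _ (sym3 0 0 c 1 e 0) hP; rewrite A20 mulmx0 mul0mx.
  by move=> /matrixP /(_ 1 1); rewrite !mxE /= => /eqP; rewrite eq_sym oner_eq0.
split; last first.
  move=> [c1 [c2 [c3 [c4 [c5 [c6 [c7 [c8 [Pt [hPt [A1 [A2 [A3 [types ->]]]]]]]]]]]]]].
  case: types => [[-> A2E [mu mu0 ->] A20]|[-> -> ->]].
    rewrite A2E in A20 *; split; last exact: slice_dim3.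
    apply: psd_slice => // a b c d e f psdX _; exact: (psd_sym3_pos_diag _ a b c d e f mu).
  have A20 := type2_neq0 Pt c4 c5 hPt.
  split; last exact: slice_dim3.
  apply: psd_slice => // a b c d e f /psd_sym3_diag [_ _ db fce] h2 h3.
  (* The equation of [A3] is [f = 0], which clears [c] and [e]; that of [A2] then reduces to
     [d = 0], which clears [b]. *)
  have f0 : f = 0 by lra.
  have [c0 e0] := fce f0.
  have d0 : d = 0 by move: h2; rewrite c0 e0; lra.
  by split=> //; exact: db.
move=> [psdE [X0 [V [symX0 symV EE dimV]]]].
have [u uV uE] : exists2 u, u \in V & X0 + u = Ustar R.
  have : (@psd_cone R 3 `&` E) (Ustar R) by rewrite psdE.
  by rewrite EE => -[_ [u uV uE]]; exists u.
(* The base point moves from [X0] to [Ustar], which differs from it by [u] in [V]. *)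
have {}EE : E = [set Ustar R + v | v in [set` V]].
  rewrite EE -uE; apply/seteqP; split=> X /= -[v vV <-].
    by exists (v - u); rewrite ?rpredB // -addrA (addrC u) subrK.
  by exists (u + v); rewrite ?rpredD // addrA.
have {}symV v : v \in V -> v^T = v by move=> /symV /sym_spaceP.
(* A feasible direction [v] puts some [Ustar + t v] with [t > 0] into the intersection, so
   [v = 0]. *)
have feasV : no_feasible_direction V.
  move=> v k vV hk; have [t t0 psdt] := psd_Ustar_add v k (symV v vV) hk.
  have : (@psd_cone R 3 `&` E) (Ustar R + t *: v).
    by split=> //; rewrite EE; exists (t *: v) => //=; rewrite rpredZ.
  rewrite psdE /= => /eqP; rewrite -subr_eq0 addrAC subrr add0r scaler_eq0.
  by rewrite gt_eqF //= => /eqP.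
have [p [q [r [tr_gt0 det_ge0 BV]]]] := psd2_orthogonal V symV feasV.
have [Pt [l [mu [hPt l0 mu_ge0 BE]]]] := sym2_diagonalization p q r tr_gt0 det_ge0.
have A3V v : v \in V ->
    mx_inner (diag_block1 Pt *m sym3 0 0 0 mu 0 1 *m (diag_block1 Pt)^T) v = 0.
  move=> /BV; rewrite BE mx_innerC linearZ /= mx_innerC => /eqP.
  by rewrite mulf_eq0 gt_eqF //= => /eqP.
have [mu0|mu0] := eqVneq mu 0.
  rewrite mu0 in A3V.
  have [c1 [c2 [c3 [c4 [c5 [A1V A2V]]]]]] := equations_type2 V Pt hPt symV feasV A3V.
  exists c1, c2, c3, c4, c5, 0, 0, 0, Pt; split=> //.
  do 3 eexists; split; first by right.
  rewrite EE; apply: slice_eq_translate => //; exact: type2_neq0.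
have mu_gt0 : 0 < mu by rewrite lt_neqAle eq_sym mu0.
have [c1 [c2 [c3 [c4 [c5 [c6 [c7 [c8 [A20 A1V A2V]]]]]]]]] :=
  equations_type1 V Pt mu hPt symV dimV feasV A3V.
exists c1, c2, c3, c4, c5, c6, c7, c8, Pt; split=> //.
do 3 eexists; split; first by left; split=> //; exists mu.
by rewrite EE; exact: slice_eq_translate.
Qed.
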